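(* Let $G$ be a finite group, let $\pi:G\to \mathrm U(n)$, $g\mapsto \pi(g)=:U_g$, be a unitary $t$-design with $t\ge 2$, and let $H_s\in i\,\mathfrak{su}(n)$ be a traceless Hermitian matrix. Then any subset of $\{U_gH_sU_g^*\}_{g\in G}$, where one element is removed, still spans $i\,\mathfrak{su}(n)$.
   Context: $i\,\mathfrak{su}(n)$ denotes the real vector space of traceless Hermitian $n\times n$ matrices; spans are over $\mathbb R$. $U^*$ is the conjugate transpose. ''Any subset where one element is removed'' means any collection obtained from $\{U_gH_sU_g^*\}_{g\in G}$ by removing one element. A unitary representation $\pi:G\to\mathrm U(n)$, $g\mapsto U_g$, of a finite group $G$ is called a unitary $t$-design if for all $H\in\mathbb C^{n^t\times n^t}$ $$\frac1{|G|}\sum_{g\in G} U_g^{\otimes t}\,H\,(U_g^{\otimes t})^* = \int_{\mathrm U(n)} U^{\otimes t}\,H\,(U^{\otimes t})^*\,dU,$$ where $dU$ is the normalized Haar measure on $\mathrm U(n)$.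
   Formalization: The formal statement additionally assumes that H_s is nonzero when n ≥ 2; for H_s = 0 and n ≥ 2 the claim is false, since the orbit of 0 spans only {0}. *)

(* Defs.v *)
From HB Require Import structures.
From mathcomp Require Import all_boot all_order all_algebra all_fingroup.
From mathcomp Require Import mxrepresentation complex.
From mathcomp Require mxtens.
From mathcomp Require Import all_classical all_reals all_analysis.

Set Implicit Arguments.
Unset Strict Implicit.
Unset Printing Implicit Defensive.

Import Order.TTheory GRing.Theory Num.Theory.

Local Open Scope classical_set_scope.
Local Open Scope ring_scope.
Local Open Scope complex_scope.
Local Open Scope sesquilinear_scope.

(* R[i] does not come with a topology; R[i]^o carries the one given by the
   modulus.  Matrices over R[i] then get the product topology. *)
HB.instance Definition _ (R : rcfType) :=
  PseudoPointedMetric.copy R[i] R[i]^o.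

Definition unitary_group (R : realType) (n : nat) : set 'M[R[i]]_n :=
  [set U | U \is unitarymx].

Arguments unitary_group : clear implicits.

(* The group U(n) as a type, with the topology induced by that of matrices. *)
Definition unitary (R : realType) (n : nat) : Type :=
  set_type (unitary_group R n).

HB.instance Definition _ (R : realType) (n : nat) :=
  Topological.on (unitary R n).

Definition mx_of_unitary (R : realType) (n : nat) (U : unitary R n) :
  'M[R[i]]_n := set_val U.

Coercion mx_of_unitary : unitary >-> matrix.

Lemma mx_of_unitaryP (R : realType) (n : nat) (U : unitary R n) :
  (U : 'M[R[i]]_n) \is unitarymx.
Proof. exact: (set_valP U). Qed.

Definition to_unitary (R : realType) (n : nat) (M : 'M[R[i]]_n)
  (hM : M \is unitarymx) : unitary R n :=
  SigSub (mem_set (hM : unitary_group R n M)).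

Lemma unitarymx1 (R : realType) (n : nat) :
  (1%:M : 'M[R[i]]_n) \is unitarymx.
Proof. by apply/unitarymxP; rewrite trmx1 map_mx1 mul1mx. Qed.

Definition unitary1 (R : realType) (n : nat) : unitary R n :=
  to_unitary (@unitarymx1 R n).

HB.instance Definition _ (R : realType) (n : nat) :=
  isPointed.Build (unitary R n) (unitary1 R n).

Definition unitary_mul (R : realType) (n : nat) (V U : unitary R n) :
  unitary R n :=
  to_unitary (mul_unitarymx (mx_of_unitaryP V) (mx_of_unitaryP U)).

Definition borel_unitary (R : realType) (n : nat) :=
  g_sigma_algebraType (@open (unitary R n)).

(* U(n) is compact and metrizable, so every Borel probability measure on it is
   regular and left invariance alone characterizes the normalized Haar
   measure. *)
Definition normalized_haar (R : realType) (n : nat)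
  (mu : probability (borel_unitary R n) R) : Prop :=
  forall (V : unitary R n) (A : set (borel_unitary R n)),
    measurable A -> mu (unitary_mul V @^-1` A) = mu A.

Definition mx_integral (R : realType) (n m : nat)
  (mu : probability (borel_unitary R n) R)
  (F : unitary R n -> 'M[R[i]]_m) : 'M[R[i]]_m :=
  \matrix_(i, j) ((\int[mu]_U complex.Re (F U i j)) +i*
                  (\int[mu]_U complex.Im (F U i j))).

Definition mx_conjugate (R : realType) (m : nat) (U M : 'M[R[i]]_m) :
  'M[R[i]]_m := U *m M *m U^t*.

Definition unitary_representation (R : realType) (n : nat)
  (gT : finGroupType) (G : {group gT}) (rG : mx_representation R[i] G n) :
  Prop := forall g, g \in G -> rG g \is unitarymx.

Definition unitary_design (R : realType) (n : nat)
  (mu : probability (borel_unitary R n) R)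
  (gT : finGroupType) (G : {group gT}) (rG : mx_representation R[i] G n)
  (t : nat) : Prop :=
  unitary_representation rG /\
  forall H : 'M[R[i]]_(n ^ t),
    #|G|%:R^-1 *: (\sum_(g in G) mx_conjugate (mxtens.ntensmx (rG g) t) H)
    = mx_integral mu
        (fun U => mx_conjugate (mxtens.ntensmx (U : 'M[R[i]]_n) t) H).

Definition isu (R : realType) (n : nat) : set 'M[R[i]]_n :=
  [set M | M \is hermsymmx /\ \tr M = 0].

Arguments isu : clear implicits.

Definition real_span (R : realType) (n : nat) (S : set 'M[R[i]]_n) :
  set 'M[R[i]]_n :=
  [set M | exists (k : nat) (a : 'I_k -> R) (X : 'I_k -> 'M[R[i]]_n),
     (forall i, S (X i)) /\ M = \sum_(i < k) (a i)%:C *: X i].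

(* Main.v *)
(* Put X_g = U_g H_s U_g^*. Pairing the design identity with K (x) K (x) 1
   on one side and H (x) H (x) 1 on the other, left invariance of the Haar
   measure shows that sum_g tr(K V X_g V^* )^2 does not depend on the
   unitary V. If K is Hermitian, traceless and orthogonal to every X_g,
   this sum vanishes for V = 1, hence for all V, so K is orthogonal to the
   whole unitary orbit of H_s. Diagonalising K and H_s and letting V run
   through permutations of the eigenbases forces one of them to be scalar,
   hence zero; thus K = 0 and the X_g span. The sum S of the X_g is fixed
   by G; were it nonzero, the same result applied to S would make i su(n) a
   line, so S = 0. Therefore the removed element X is a multiple of the sum
   of the remaining X_g. *)
Require Import Defs.
From mathcomp Require Import all_boot all_order all_algebra all_fingroup.
From mathcomp Require Import mxrepresentation complex.
From mathcomp Require mxtens.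
From mathcomp Require Import all_classical all_reals all_analysis.
From mathcomp Require Import measurable_realfun ring.

Set Implicit Arguments.
Unset Strict Implicit.
Unset Printing Implicit Defensive.

Import Order.TTheory GRing.Theory Num.Theory.
Import numFieldNormedType.Exports.

Local Open Scope classical_set_scope.
Local Open Scope ring_scope.
Local Open Scope sesquilinear_scope.

(** * Hermitian matrices and unitary orbits *)

Lemma mxtrace_mul_rect (F : comPzRingType) (m n : nat) (A : 'M[F]_(m, n))
    (B : 'M[F]_(n, m)) :
  \tr (A *m B) = \sum_(p : 'I_m * 'I_n) A p.1 p.2 * B p.2 p.1.
Proof.
rewrite -(pair_bigA _ (fun i j => A i j * B j i)) /=.
by apply: eq_bigr => i _; rewrite mxE.
Qed.

(** Stack the vectorised [X i] as rows: a matrix outside their span is detected by a column of the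
    cokernel, and through the trace pairing such a column is a matrix orthogonal to every [X i]. *)
Lemma matrix_span_dual (F : fieldType) (m n k : nat)
  (X : 'I_k -> 'M[F]_(m, n)) (M : 'M[F]_(m, n)) :
  (forall Y : 'M[F]_(n, m),
    (forall i, \tr (Y *m X i) = 0) -> \tr (Y *m M) = 0) ->
  exists a : 'I_k -> F, M = \sum_i a i *: X i.
Proof.
move=> dual; pose A := \matrix_i mxvec (X i).
have trE (y : 'cV[F]_(m * n)) (Z : 'M[F]_(m, n)) :
    mxvec Z *m y = (\tr ((vec_mx y^T)^T *m Z))%:M.
  apply/matrixP => i j; rewrite !ord1 mxtrace_mulC mxtrace_mul_rect !mxE /=.
  rewrite mulr1n (reindex _ (curry_mxvec_bij m n)) /=.
  by apply: eq_bigr => -[p q] _ /=; rewrite mxvecE !mxE.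
have [/submxP[D eD]|] := boolP (mxvec M <= A)%MS.
  exists (D 0); apply: (can_inj mxvecK); rewrite eD linear_sum /=.
  rewrite mulmx_sum_row; apply: eq_bigr => i _.
  by rewrite linearZ /= rowK.
rewrite submxE => /eqP[]; apply/rowP => j.
have -> : (mxvec M *m cokermx A) 0 j = (mxvec M *m col j (cokermx A)) 0 0.
  by rewrite [LHS]mxE [RHS]mxE; apply: eq_bigr => i _; rewrite [in RHS]mxE.
rewrite trE !mxE mulr1n; apply: dual => i.
have : row i A *m col j (cokermx A) = 0.
  by rewrite colE mulmxA -row_mul mulmx_coker row0 mul0mx.
by rewrite rowK trE => /matrixP/(_ 0 0); rewrite !mxE mulr1n.
Qed.

Section Hermitian.
Variable C : numClosedFieldType.

Lemma hermsymmxE (n : nat) (M : 'M[C]_n) : M \is hermsymmx -> M^t* = M.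
Proof. by move/is_hermitianmxP; rewrite scale1r => {2}->. Qed.

Lemma hermsymmxI (n : nat) (M : 'M[C]_n) : M^t* = M -> M \is hermsymmx.
Proof. by move=> eM; apply/is_hermitianmxP; rewrite scale1r. Qed.

Lemma trmxC_mul (m n p : nat) (A : 'M[C]_(m, n)) (B : 'M[C]_(n, p)) :
  (A *m B)^t* = B^t* *m A^t*.
Proof. by rewrite trmx_mul map_mxM. Qed.

Lemma mxtrace_trmxC (n : nat) (A : 'M[C]_n) : \tr (A^t*) = (\tr A)^*.
Proof. by rewrite trace_map_mx mxtrace_tr. Qed.

Lemma herm_trace_real (n : nat) (A B : 'M[C]_n) :
  A^t* = A -> B^t* = B -> (\tr (A *m B))^* = \tr (A *m B).
Proof.
by move=> hA hB; rewrite -mxtrace_trmxC trmxC_mul hA hB mxtrace_mulC.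
Qed.

Lemma scalar_traceless (n : nat) (A : 'M[C]_n) :
  is_scalar_mx A -> \tr A = 0 -> A = 0.
Proof.
case: n A => [|n] A; first by move=> _ _; rewrite [A]flatmx0.
move=> /is_scalar_mxP[a ->]; rewrite mxtrace_scalar => /eqP.
by rewrite mulrn_eq0 /= => /eqP->; rewrite raddf0.
Qed.

(* Exchanging the images of i and j in a permutation with s i = a and s j = b
   changes the sum by (d i - d j) (e a - e b). *)
Lemma perm_sum_nondegenerate (n : nat) (d e : 'I_n -> C) (c : C) :
  (forall s : 'S_n, \sum_i d i * e (s i) = c) ->
  (forall i j, d i = d j) \/ (forall a b, e a = e b).
Proof.
move=> sumE; have [dP|] := pselect (forall i j, d i = d j); first by left.
move=> /existsNP[i /existsNP[j dij]]; right => a b.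
have [->//|ab] := eqVneq a b.
have ij : i != j by apply: contra_notN dij => /eqP->.
have ji : j != i by rewrite eq_sym.
(* The first transposition sends [i] to [a]; the second moves the image of [j] to [b] and fixes [a],
   which is neither of its two points. *)
have [s si sj] : exists2 s : 'S_n, s i = a & s j = b.
  exists (tperm i a * tperm (tperm i a j) b)%g; last by rewrite permM tpermL.
  have ba : b != a by rewrite eq_sym.
  have ja : tperm i a j != a.
    by rewrite -[a in _ != a](tpermL i a) (inj_eq perm_inj).
  by rewrite permM tpermL (tpermD ja ba).
have := sumE s; rewrite -(sumE (tperm i j * s)%g).
rewrite (bigD1 i) //= (bigD1 j) //=.
rewrite [in RHS](bigD1 i) //= [in RHS](bigD1 j) //=.
rewrite !permM tpermL tpermR si sj.
rewrite [X in _ + (_ + X) = _](eq_bigr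
  (fun k => d k * e ((tperm i j * s)%g k))).
  move/eqP; rewrite !addrA (inj_eq (addIr _)) => /eqP h.
  have /eqP : (d i - d j) * (e a - e b) = 0.
    rewrite mulrBl !mulrBr opprB.
    by rewrite -[RHS](subrr (d i * e a + d j * e b)) {2}h; ring.
  by rewrite mulf_eq0 !subr_eq0 => /orP[] /eqP.
move=> k /andP[kj ki]; by rewrite permM tpermD // eq_sym.
Qed.

Lemma unitary_diag_scalar (n : nat) (A U : 'M[C]_n) (f : 'rV[C]_n) :
  U \is unitarymx -> A = U^t* *m diag_mx f *m U ->
  (forall i j, f 0 i = f 0 j) -> is_scalar_mx A.
Proof.
case: n A U f => [|n] A U f uU -> fE.
  by apply/is_scalar_mxP; exists 0; rewrite [LHS]flatmx0 [RHS]flatmx0.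
have -> : diag_mx f = (f 0 0)%:M.
  by apply/matrixP => i j; rewrite !mxE (fE i 0).
have UtU : U^t* *m U = 1%:M by apply: mulmx1C; apply/unitarymxP.
apply/is_scalar_mxP; exists (f 0 0).
by rewrite mul_mx_scalar -scalemxAl UtU scalemx1.
Qed.

Lemma unitary_orbit_nondegenerate (n : nat) (K H : 'M[C]_n) :
  K \is hermsymmx -> H \is hermsymmx ->
  (forall V : 'M[C]_n, V \is unitarymx -> \tr (K *m (V *m H *m V^t*)) = 0) ->
  is_scalar_mx K \/ is_scalar_mx H.
Proof.
move=> /hermitian_normalmx/orthomx_spectralP hK.
move=> /hermitian_normalmx/orthomx_spectralP hH orth.
move: (spectral_unitarymx K) (spectral_unitarymx H) hK hH.
move: (spectralmx K) (spectralmx H) (spectral_diag K) (spectral_diag H).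
move=> P Q d e uP uQ; rewrite !invmx_unitary // => hK hH.
suff [dE|eE] : (forall i j, d 0 i = d 0 j) \/ (forall a b, e 0 a = e 0 b).
- by left; apply: unitary_diag_scalar uP hK dE.
- by right; apply: unitary_diag_scalar uQ hH eE.
apply: (@perm_sum_nondegenerate n (d 0) (e 0) 0) => s.
pose S : 'M[C]_n := perm_mx s.
have StE : S^t* = S^T by rewrite /S tr_perm_mx map_perm_mx.
have SSt : S *m S^T = 1%:M by rewrite /S tr_perm_mx -perm_mxM mulgV perm_mx1.
have uS : S \is unitarymx by apply/unitarymxP; rewrite StE.
(* This unitary matches the eigenbases of [H] and [K] up to the permutation [s], so the trace
   becomes the sum of [d 0 i * e 0 (s i)]. *)
have uV : P^t* *m S *m Q \is unitarymx.
  by rewrite !mul_unitarymx // trmxC_unitary.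
have := orth _ uV; rewrite !trmxC_mul trmxCK hH hK StE !mulmxA.
have PPt : P *m P^t* = 1%:M by apply/unitarymxP.
have QQt : Q *m Q^t* = 1%:M by apply/unitarymxP.
rewrite -(mulmxA _ Q (Q^t*)) QQt mulmx1 -(mulmxA _ Q (Q^t*)) QQt mulmx1.
rewrite mxtrace_mulC !mulmxA PPt mul1mx -(mulmxA _ P (P^t*)) PPt mulmx1 => trE.
rewrite -[RHS]trE.
rewrite -!mulmxA mul_diag_mx /mxtrace; apply: eq_bigr => i _; rewrite !mxE.
congr (_ * _); rewrite (bigD1 (s i)) //= big1 ?addr0 => [|j ji].
  rewrite !mxE eqxx mul1r (bigD1 (s i)) //= big1 ?addr0 => [|k ki].
    by rewrite !mxE !eqxx mulr1n mulr1.
  by rewrite !mxE eq_sym (negPf ki) mulr0n mul0r.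
by rewrite !mxE eq_sym (negPf ji) mul0r.
Qed.

End Hermitian.

(** * Real spans and duality in the space of traceless Hermitian matrices *)

Section Span.
Variables (R : realType) (n : nat).
Implicit Types (M : 'M[R[i]]_n) (S : set 'M[R[i]]_n).

Lemma isuP M : isu R n M <-> M^t* = M /\ \tr M = 0.
Proof.
by split=> -[hM tM]; split=> //; [exact: hermsymmxE | exact: hermsymmxI].
Qed.

Lemma mx_conjugate_trmxC (U M : 'M[R[i]]_n) :
  (mx_conjugate U M)^t* = mx_conjugate U (M^t*).
Proof. by rewrite /mx_conjugate !trmxC_mul trmxCK mulmxA. Qed.

Lemma mxtrace_conjugate (U M : 'M[R[i]]_n) :
  U \is unitarymx -> \tr (mx_conjugate U M) = \tr M.
Proof.
move=> uU; rewrite /mx_conjugate mxtrace_mulC mulmxA.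
suff -> : U^t* *m U = 1%:M by rewrite mul1mx.
by apply: mulmx1C; apply/unitarymxP.
Qed.

Lemma isu_conjugate (U M : 'M[R[i]]_n) :
  U \is unitarymx -> isu R n M -> isu R n (mx_conjugate U M).
Proof.
move=> uU /isuP[hM tM]; apply/isuP.
by rewrite mx_conjugate_trmxC hM mxtrace_conjugate.
Qed.

Lemma isu_sum (I : finType) (P : pred I) (a : I -> R) (X : I -> 'M[R[i]]_n) :
  (forall i, P i -> isu R n (X i)) ->
  isu R n (\sum_(i | P i) (a i)%:C%C *: X i).
Proof.
move=> hX; apply/isuP; split.
  rewrite !raddf_sum /=; apply: eq_bigr => i Pi.
  have /isuP[hXi _] := hX i Pi.
  rewrite !linearZ /= -[RHS]/(_ *: X i) -{2}hXi map_mxZ; congr (_ *: _).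
  exact: conjc_real.
rewrite raddf_sum big1 // => i Pi; have [_ ti] := hX i Pi.
by rewrite /= mxtraceZ ti mulr0.
Qed.

Lemma real_span_sum S (I : finType) (P : pred I) (a : I -> R)
    (X : I -> 'M[R[i]]_n) :
  (forall i, P i -> S (X i)) ->
  real_span S (\sum_(i | P i) (a i)%:C%C *: X i).
Proof.
move=> hX; exists #|P|, (a \o enum_val), (X \o enum_val); split=> [j|].
  exact/hX/(enum_valP j).
by rewrite big_enum_val.
Qed.

Lemma real_span_mono S S' : S `<=` S' -> real_span S `<=` real_span S'.
Proof.
by move=> sS M [k [a [X [hX ->]]]]; exists k, a, X; split=> // i; exact/sS.
Qed.

Lemma real_span_isu S : S `<=` isu R n -> real_span S `<=` isu R n.
Proof. by move=> sS M [k [a [X [hX ->]]]]; apply: isu_sum => i _; exact/sS. Qed.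

(** Duality is first applied over the complex numbers. An arbitrary complex test matrix reduces to
    traceless Hermitian ones, so the hypothesis leaves only scalar test matrices, and these pair to
    zero with the traceless [M]. *)
Lemma real_span_dual (k : nat) (X : 'I_k -> 'M[R[i]]_n) M :
  (forall i, isu R n (X i)) ->
  (forall K, isu R n K -> (forall i, \tr (K *m X i) = 0) -> K = 0) ->
  isu R n M -> exists a : 'I_k -> R, M = \sum_i (a i)%:C%C *: X i.
Proof.
move=> hX dual /isuP[hM tM].
have [n0|n_gt0] := posnP n.
  exists (fun=> 0); apply/matrixP => i.
  by have := ltn_ord i; rewrite [X in (_ < X)%N]n0.
have nN0 : n%:R != 0 :> R[i] by rewrite pnatr_eq0 -lt0n.
have [Y orthY|c eM] := @matrix_span_dual _ _ _ _ X M.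
  (* Removing the scalar part of [Y] does not change its pairing with traceless matrices. *)
  pose z := \tr Y / n%:R; pose Y0 := Y - z%:M.
  have tY0 : \tr Y0 = 0.
    by rewrite /Y0 raddfB /= mxtrace_scalar -[z *+ n]mulr_natr mulfVK ?subrr.
  have orthY0 i : \tr (Y0 *m X i) = 0.
    have [_ ti] := hX i.
    by rewrite mulmxBl raddfB /= orthY mul_scalar_mx mxtraceZ ti mulr0 subrr.
  have orthY0C i : \tr (Y0^t* *m X i) = 0.
    have /isuP[hi _] := hX i.
    by rewrite -{1}hi -trmxC_mul mxtrace_trmxC mxtrace_mulC orthY0 conjC0.
  have tY0C : \tr (Y0^t*) = 0 by rewrite mxtrace_trmxC tY0 conjC0.
  (* [Y0 + Y0^t*] and ['i] times [Y0 - Y0^t*] are both Hermitian, traceless and orthogonal to the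
     [X i], so [dual] annihilates the two parts of [Y0]. *)
  have addE : Y0 + Y0^t* = 0.
    apply: dual => [|i]; last by rewrite mulmxDl raddfD /= orthY0 orthY0C addr0.
    apply/isuP; split; last by rewrite raddfD /= tY0 tY0C addr0.
    by rewrite linearD map_mxD /= trmxCK addrC.
  have subE : 'i *: (Y0 - Y0^t*) = 0.
    apply: dual => [|i]; last first.
      rewrite -scalemxAl mulmxBl mxtraceZ raddfB /=.
      by rewrite orthY0 orthY0C subrr mulr0.
    apply/isuP; split; last by rewrite mxtraceZ raddfB /= tY0 tY0C subrr mulr0.
    rewrite linearZ linearB map_mxZ map_mxB /= trmxCK.
    by rewrite conjCi scaleNr -scalerN opprB.
  have Y00 : Y0 = 0.
    move/eqP: subE.
    rewrite scaler_eq0 (negPf (neq0Ci _)) subr_eq0 /= => /eqP eY.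
    move: addE; rewrite -eY -mulr2n => /eqP.
    by rewrite -scaler_nat scaler_eq0 pnatr_eq0 => /eqP.
  have -> : Y = z%:M by apply/eqP; rewrite -subr_eq0; apply/eqP.
  by rewrite mul_scalar_mx mxtraceZ tM mulr0.
(* M and the X i are Hermitian, so taking Hermitian parts replaces the
   coefficients by their real parts. *)
exists (fun i => complex.Re (c i)).
have two0 : (2 : R[i]) != 0 by rewrite pnatr_eq0.
apply: (scalerI two0); rewrite scaler_nat mulr2n -{2}hM {1 2}eM.
rewrite !raddf_sum -big_split /=; apply: eq_bigr => i _.
have /isuP[hi _] := hX i.
by rewrite linearZ /= map_mxZ hi -scalerDl scalerA addcJ.
Qed.

End Span.

(** The Pauli matrices sigma_z and sigma_x, placed in the top left corner, are not proportional: the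
    (0, 0) entry of the first forces [S 0 0 != 0], and that of the second then forces its
    coefficient to be zero. *)
Lemma isu_not_line (R : realType) (n : nat) (S : 'M[R[i]]_n) : (1 < n)%N ->
  ~ (forall M, isu R n M -> exists c, M = c *: S).
Proof.
case: n S => [|[|m]] // S _ line.
pose A : 'M[R[i]]_m.+2 := delta_mx 0 0 - delta_mx 1 1.
pose B : 'M[R[i]]_m.+2 := delta_mx 0 1 + delta_mx 1 0.
have deltaC (i j : 'I_m.+2) : (delta_mx i j)^t* = delta_mx j i :> 'M[R[i]]_m.+2.
  by rewrite trmx_delta map_delta_mx.
have deltaT (i j : 'I_m.+2) : \tr (delta_mx i j) = ((i == j)%:R : R[i]).
  rewrite /mxtrace (bigD1 i) //= big1 => [|k ki]; rewrite mxE ?(negPf ki) //.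
  by rewrite eqxx addr0.
have [|a eA] := line A.
  apply/isuP; split; first by rewrite linearB map_mxB /= !deltaC.
  by rewrite raddfB /= !deltaT subrr.
have [|b eB] := line B.
  apply/isuP; split; first by rewrite linearD map_mxD /= !deltaC addrC.
  by rewrite raddfD /= !deltaT addr0.
have := congr1 (fun M : 'M[R[i]]_m.+2 => M 0 0) eA.
have := congr1 (fun M : 'M[R[i]]_m.+2 => M 0 0) eB.
have := congr1 (fun M : 'M[R[i]]_m.+2 => M 0 1) eB.
rewrite !mxE /= !addr0 subr0 => b01 b00 a00.
have S00 : S 0 0 != 0.
  by apply: contra_eq_neq a00 => ->; rewrite mulr0 oner_eq0.
have b0 : b = 0.
  by move/esym/eqP: b00; rewrite mulf_eq0 (negPf S00) orbF => /eqP.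
by move/eqP: b01; rewrite b0 mul0r oner_eq0.
Qed.

(** * Orbits of a group whose second trace moments are invariant under unitary conjugation *)

Section Orbit.
Variables (R : realType) (n : nat) (gT : finGroupType) (G : {group gT}).
Variable rG : mx_representation R[i] G n.
Hypothesis uG : unitary_representation rG.
Hypothesis moment : forall K H V : 'M[R[i]]_n, V \is unitarymx ->
  \sum_(g in G) (\tr (K *m mx_conjugate V (mx_conjugate (rG g) H))) ^+ 2 =
  \sum_(g in G) (\tr (K *m mx_conjugate (rG g) H)) ^+ 2.

Lemma orbit_dual (H K : 'M[R[i]]_n) : isu R n H -> H != 0 -> isu R n K ->
  (forall g, g \in G -> \tr (K *m mx_conjugate (rG g) H) = 0) -> K = 0.
Proof.
move=> iH H0 iK orth; have [hH tH] := iH; have [hK tK] := iK.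
have [V uV|sK|sH] := unitary_orbit_nondegenerate hK hH.
- have := moment K H uV.
  rewrite [RHS]big1 => [/eqP|g gG]; last by rewrite orth // expr0n.
  (* Traces of products of two Hermitian matrices are real, so the squares are nonnegative and each
     vanishes; the term at [1%g] gives orthogonality to [mx_conjugate V H]. *)
  rewrite psumr_eq0 => [/allP/(_ 1%g)|g gG].
    rewrite mem_index_enum group1 sqrf_eq0 => /(_ isT)/eqP.
    by rewrite {2}/mx_conjugate repr_mx1 trmx1 map_mx1 mul1mx mulmx1.
  have /isuP[hX _] := isu_conjugate uV (isu_conjugate (uG gG) iH).
  have /eqP := herm_trace_real (hermsymmxE hK) hX.
  by rewrite -CrealE => /real_exprn_even_ge0 ->.
- exact: scalar_traceless.
- by rewrite (scalar_traceless sH tH) eqxx in H0.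
Qed.

Lemma orbit_span (H M : 'M[R[i]]_n) : isu R n H -> H != 0 -> isu R n M ->
  exists a : gT -> R, M = \sum_(g in G) (a g)%:C%C *: mx_conjugate (rG g) H.
Proof.
move=> iH H0 iM.
pose X (j : 'I_#|G|) := mx_conjugate (rG (enum_val j)) H.
have [j|K iK orth|a ->] := @real_span_dual _ _ _ X M _ _ iM.
- exact/isu_conjugate/iH/uG/enum_valP.
- apply: orbit_dual iH H0 iK _ => g gG.
  by have := orth (enum_rank_in gG g); rewrite /X enum_rankK_in.
(* Coefficients indexed by ordinals become coefficients indexed by [gT], with default 0 off [G];
   matching on the reflection view supplies the membership proof that [enum_rank_in] takes. *)
exists (fun g =>
  if g \in G =P true is ReflectT gG then a (enum_rank_in gG g) else 0).
rewrite [RHS]big_enum_val /=; apply: eq_bigr => j _; case: eqP => [jG|].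
  by rewrite enum_valK_in.
by rewrite enum_valP.
Qed.

(* A nonzero sum would be fixed by G, so its orbit could only span a line. *)
Lemma orbit_sum (H : 'M[R[i]]_n) : (1 < n)%N -> isu R n H ->
  \sum_(g in G) mx_conjugate (rG g) H = 0.
Proof.
move=> n_gt1 iH; set S := LHS; apply/eqP/negP => /negP S0.
have iS : isu R n S.
  rewrite [S](_ : _ = \sum_(g in G) 1%:C%C *: mx_conjugate (rG g) H).
    by apply: isu_sum => g gG; exact/isu_conjugate/iH/uG.
  by apply: eq_bigr => g _; rewrite scale1r.
have fixS h : h \in G -> mx_conjugate (rG h) S = S.
  move=> hG; rewrite [RHS](reindex_inj (mulgI h)) /=.
  rewrite [RHS](eq_bigl (mem G)) => [|g]; last by rewrite /= groupMl.
  rewrite {1}/mx_conjugate mulmx_sumr mulmx_suml; apply: eq_bigr => g gG.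
  by rewrite /mx_conjugate repr_mxM // trmxC_mul !mulmxA.
have line M : isu R n M -> exists c, M = c *: S.
  move=> /(orbit_span iS S0)[a ->]; exists (\sum_(g in G) (a g)%:C%C).
  by rewrite scaler_suml; apply: eq_bigr => g gG; rewrite fixS.
exact: isu_not_line line.
Qed.

(** Several group elements may give the same matrix [X], and all of them disappear with it. As the
    whole orbit sums to zero, a positive multiple of [X] is minus the sum of the surviving terms. *)
Lemma orbit_span_remove (H X : 'M[R[i]]_n) :
  isu R n H -> ((1 < n)%N -> H != 0) ->
  [set mx_conjugate (rG g) H | g in [set` G]] X ->
  isu R n `<=` real_span ([set mx_conjugate (rG g) H | g in [set` G]] `\ X).
Proof.
move=> iH H0 [g0 g0G eX] M iM.
have [n_le1|n_gt1] := leqP n 1.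
  (* In dimension at most 1 a traceless matrix is zero, which is the empty combination. *)
  have -> : M = \sum_(i : 'I_0) (0 : R)%:C%C *: (0 : 'M[R[i]]_n).
    rewrite big_ord0; apply: scalar_traceless; last by case: iM.
    apply/is_scalar_mxP; case: n n_le1 {iM} M => [|[|//]] _ M.
      by exists 0; rewrite [LHS]flatmx0 [RHS]flatmx0.
    by exists (M 0 0); rewrite -mx11_scalar.
  by apply: real_span_sum => -[].
have [a eM] := orbit_span iH (H0 n_gt1) iM.
pose Y g := mx_conjugate (rG g) H.
(* [m] counts the group elements that give [X], and [A] is the total coefficient of [X] in the
   expansion of [M]. *)
pose m : R := \sum_(g in G | Y g == X) 1.
pose A : R := \sum_(g in G | Y g == X) a g.
have m0 : m%:C%C != 0.
  rewrite fmorph_eq0 gt_eqF // /m (bigD1 g0) /=; last by rewrite -eX eqxx andbT.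
  by rewrite ltr_wpDr ?ltr01 // sumr_ge0.
have sumX (b : gT -> R) : \sum_(g in G | Y g == X) (b g)%:C%C *: Y g =
    (\sum_(g in G | Y g == X) b g)%:C%C *: X.
  by rewrite raddf_sum scaler_suml; apply: eq_bigr => g /andP[_ /eqP->].
have sum0 : m%:C%C *: X = - \sum_(g in G | Y g != X) Y g.
  apply/eqP; rewrite -addr_eq0 -(sumX (fun=> 1)).
  under eq_bigr do rewrite scale1r.
  by rewrite -bigID orbit_sum.
(* Substituting the expression for [X] spreads [A] evenly: each surviving coefficient drops by
   [A / m]. *)
have -> : M = \sum_(g in G | Y g != X) (a g - A / m)%:C%C *: Y g.
  rewrite eM (bigID (fun g => Y g == X)) /= sumX -/A.
  have -> : A%:C%C *: X = (A / m)%:C%C *: (m%:C%C *: X).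
    by rewrite scalerA -rmorphM /= divfK // -(fmorph_eq0 (real_complex R)).
  rewrite sum0 scalerN scaler_sumr addrC -sumrB; apply: eq_bigr => g _.
  by rewrite rmorphB scalerBl.
apply: real_span_sum => g /andP[gG gX]; split; first by exists g.
exact/eqP.
Qed.

End Orbit.

(** * Integration over the unitary group *)

Lemma mx_entry_continuous (T : topologicalType) (m n : nat) (i : 'I_m)
    (j : 'I_n) :
  continuous (fun M : 'M[T]_(m, n) => M i j).
Proof.
move=> M A nA; exists (fun k l => if (k == i) && (l == j) then A else setT).
  by move=> k l; case: ifP => [/andP[/eqP-> /eqP->]//|_]; exact: filterT.
by move=> N /(_ i j); rewrite !eqxx.
Qed.

Lemma mx_continuous (S T : topologicalType) (m n : nat)
    (f : S -> 'M[T]_(m, n)) :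
  (forall i j, continuous (fun x => f x i j)) -> continuous f.
Proof.
move=> cf x A [P nP sPA]; rewrite nbhs_simpl /=.
have : \forall y \near x, forall i j, P i j (f y i j).
  apply: filter_forall => i; apply: filter_forall => j; exact: cf.
by apply: filterS => y /sPA.
Qed.

(** * Continuity of real and imaginary parts, sums and scalings over the complex numbers *)

Section ComplexTopology.
Variable R : realType.

(** Balls of [R[i]] have complex radii, but positivity in the order of [R[i]] forces a zero
    imaginary part, so real radii suffice. *)
Lemma complex_nbhsP (z : R[i]) (A : set R[i]) :
  nbhs z A <-> exists2 e : R, 0 < e & forall w, `|z - w| < e%:C%C -> A w.
Proof.
split=> [/nbhs_ballP[e /= e0 sA]|[e e0 sA]].
  move: e0; rewrite ltcE /= => /andP[/eqP ie re].
  exists (complex.Re e) => // w zw.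
  apply: sA; rewrite /ball /= /ball_ /=; move: zw; congr (_ < _).
  by case: e ie {re} => a b /= ->.
by apply/nbhs_ballP; exists (e%:C%C); rewrite /= ?ltcR.
Qed.

Lemma Re_continuous : continuous (@complex.Re R).
Proof.
move=> z A /nbhs_ballP[e /= e0 sA]; apply/complex_nbhsP; exists e => // w zw.
apply: sA; rewrite /ball /= /ball_ /= -ltcR; apply: le_lt_trans zw.
by have := normc_ge_Re (z - w); case: z w => [a b] [c d].
Qed.

Lemma normc_ge_Im (z : R[i]) : `|complex.Im z|%:C%C <= `|z|.
Proof.
have normi : `|'i%C| = 1 :> R[i].
  by rewrite normc_def /= expr0n expr1n add0r sqrtr1.
by have := normc_ge_Re (z * 'i%C); rewrite normrM normi mulr1 ReiNIm normrN.
Qed.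

Lemma Im_continuous : continuous (@complex.Im R).
Proof.
move=> z A /nbhs_ballP[e /= e0 sA]; apply/complex_nbhsP; exists e => // w zw.
apply: sA; rewrite /ball /= /ball_ /= -ltcR; apply: le_lt_trans zw.
by have := normc_ge_Im (z - w); case: z w => [a b] [c d].
Qed.

Lemma continuous_sum (S : topologicalType) (I : finType) (F : I -> S -> R[i]) :
  (forall i, continuous (F i)) -> continuous (fun x => \sum_i F i x).
Proof.
move=> cF; apply: (@continuous_big R[i]^o I +%R 0 xpredT) => //.
exact: (@pseudometric_normed_Zmodule.add_continuous R[i] R[i]^o).
Qed.

Lemma continuous_mull (S : topologicalType) (c : R[i]) (F : S -> R[i]) :
  continuous F -> continuous (fun x => c * F x).
Proof.
by move=> cF x; apply: (@cvgM R[i] _ _ _ (cst c) F); [exact: cvg_cst|exact: cF].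
Qed.

End ComplexTopology.

(** * Borel measurability and boundedness of functions on the unitary group *)

Section Unitary.
Variables (R : realType) (n : nat).
Local Notation borel := (borel_unitary R n).

Lemma unitary_entry_continuous (i j : 'I_n) :
  continuous (fun U : unitary R n => (U : 'M[R[i]]_n) i j).
Proof.
move=> U; apply: (@continuous_comp (unitary R n) 'M[R[i]]_n R[i]
  (@mx_of_unitary R n) (fun M => M i j)); last exact: mx_entry_continuous.
exact: (@initial_continuous (unitary R n) 'M[R[i]]_n (@mx_of_unitary R n)).
Qed.

(** The topology is initial for the inclusion into matrices, and the entries of the product are
    linear in the entries of [U]. *)
Lemma unitary_mul_continuous (V : unitary R n) : continuous (unitary_mul V).
Proof.
apply: (@continuous_comp_initial (unitary R n) _ _ (@mx_of_unitary R n)).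
apply: mx_continuous => i j.
rewrite [X in continuous X](_ : _ = fun U : unitary R n =>
  \sum_k (V : 'M[R[i]]_n) i k * (U : 'M[R[i]]_n) k j); last first.
  by apply/funext => U; rewrite [LHS]mxE.
apply: continuous_sum => k; apply: continuous_mull.
exact: unitary_entry_continuous.
Qed.

Lemma unitary_mul_measurable (V : unitary R n) :
  measurable_fun setT (unitary_mul V : borel -> borel).
Proof.
apply: (@measurability _ _ borel borel _ _ (@open (unitary R n))) => //.
move=> _ [A oA <-]; rewrite setTI; apply: sub_sigma_algebra.
by move/continuousP: (@unitary_mul_continuous V); exact.
Qed.

Lemma continuous_borel_measurable (f : unitary R n -> R) :
  continuous f -> measurable_fun setT (f : borel -> R).
Proof.
move=> /continuousP cf.
apply: (measurability _ (RGenOInfty.measurableE R)) => //.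
move=> _ [_ [x ->] <-]; rewrite setTI; apply: sub_sigma_algebra.
by apply: cf; exact: interval_open.
Qed.

(** Each row of a unitary matrix has norm 1. *)
Lemma unitary_entry_le1 (U : 'M[R[i]]_n) (i j : 'I_n) :
  U \is unitarymx -> `|U i j| <= 1.
Proof.
move=> /unitarymxP/matrixP/(_ i i); rewrite !mxE eqxx => eU.
rewrite -(@expr_le1 _ 2) // -[leRHS]eU (bigD1 j) //= !mxE -normCK lerDl.
by apply: sumr_ge0 => k _; rewrite !mxE -normCK exprn_ge0.
Qed.

(** Unlike integrability, this property is stable under products, and it implies integrability for a
    probability measure. *)
Definition bounded_measurable (f : borel -> R) :=
  measurable_fun setT f /\ exists c, forall U, `|f U| <= c.

Lemma bounded_measurable_cst (c : R) : bounded_measurable (fun=> c).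
Proof. by split; [exact: measurable_cst|exists `|c|]. Qed.

Lemma bounded_measurableD (f g : borel -> R) :
  bounded_measurable f -> bounded_measurable g ->
  bounded_measurable (fun U => f U + g U).
Proof.
move=> [mf [c hf]] [mg [d hg]]; split; first exact: measurable_funD.
by exists (c + d) => U; rewrite (le_trans (ler_normD _ _)) // lerD.
Qed.

Lemma bounded_measurableM (f g : borel -> R) :
  bounded_measurable f -> bounded_measurable g ->
  bounded_measurable (fun U => f U * g U).
Proof.
move=> [mf [c hf]] [mg [d hg]]; split; first exact: measurable_funM.
by exists (c * d) => U; rewrite normrM ler_pM.
Qed.

Lemma bounded_measurableN (f : borel -> R) :
  bounded_measurable f -> bounded_measurable (fun U => - f U).
Proof.
move=> /(bounded_measurableM (bounded_measurable_cst (-1))).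
by under eq_fun do rewrite mulN1r.
Qed.

Definition cbounded_measurable (f : borel -> R[i]) :=
  bounded_measurable (fun U => complex.Re (f U)) /\
  bounded_measurable (fun U => complex.Im (f U)).

Lemma cbounded_measurable_cst (c : R[i]) : cbounded_measurable (fun=> c).
Proof. by split; exact: bounded_measurable_cst. Qed.

Lemma cbounded_measurableD (f g : borel -> R[i]) :
  cbounded_measurable f -> cbounded_measurable g ->
  cbounded_measurable (fun U => f U + g U).
Proof.
move=> [rf jf] [rg jg]; split.
  by under eq_fun do rewrite raddfD; exact: bounded_measurableD.
by under eq_fun do rewrite raddfD; exact: bounded_measurableD.
Qed.

Lemma Re_mulc (x y : R[i]) : complex.Re (x * y) =
  complex.Re x * complex.Re y + - (complex.Im x * complex.Im y).
Proof. by case: x y => [a b] [c d]. Qed.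

Lemma Im_mulc (x y : R[i]) : complex.Im (x * y) =
  complex.Re x * complex.Im y + complex.Im x * complex.Re y.
Proof. by case: x y => [a b] [c d]. Qed.

Lemma cbounded_measurableM (f g : borel -> R[i]) :
  cbounded_measurable f -> cbounded_measurable g ->
  cbounded_measurable (fun U => f U * g U).
Proof.
move=> [rf jf] [rg jg]; split.
  under eq_fun do rewrite Re_mulc.
  apply: bounded_measurableD; first exact: bounded_measurableM.
  by apply: bounded_measurableN; exact: bounded_measurableM.
under eq_fun do rewrite Im_mulc.
by apply: bounded_measurableD; exact: bounded_measurableM.
Qed.

Lemma cbounded_measurable_conj (f : borel -> R[i]) :
  cbounded_measurable f -> cbounded_measurable (fun U => (f U)^*).
Proof.
move=> [rf jf]; split.
  rewrite [X in bounded_measurable X](_ : _ = fun U => complex.Re (f U)) //.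
  by apply/funext => U; case: (f U).
rewrite [X in bounded_measurable X](_ : _ = fun U => - complex.Im (f U)).
  exact: bounded_measurableN.
by apply/funext => U; case: (f U).
Qed.

Lemma cbounded_measurable_sum (I : finType) (f : I -> borel -> R[i]) :
  (forall i, cbounded_measurable (f i)) ->
  cbounded_measurable (fun U => \sum_i f i U).
Proof.
move=> hf; elim: (index_enum I) => [|i r IH].
  by under eq_fun do rewrite big_nil; exact: cbounded_measurable_cst.
by under eq_fun do rewrite big_cons; exact: cbounded_measurableD.
Qed.

Lemma cbounded_measurable_entry (i j : 'I_n) :
  cbounded_measurable (fun U => mx_of_unitary U i j).
Proof.
split; split.
- apply: continuous_borel_measurable.
  have cRe U : {for U, continuous (@complex.Re R \o
      (fun U : unitary R n => (U : 'M[R[i]]_n) i j))}.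
    apply: continuous_comp; last exact: Re_continuous.
    exact: unitary_entry_continuous.
  exact: cRe.
- exists 1 => U; rewrite -lecR (le_trans (normc_ge_Re _)) //.
  exact/unitary_entry_le1/mx_of_unitaryP.
- apply: continuous_borel_measurable.
  have cIm U : {for U, continuous (@complex.Im R \o
      (fun U : unitary R n => (U : 'M[R[i]]_n) i j))}.
    apply: continuous_comp; last exact: Im_continuous.
    exact: unitary_entry_continuous.
  exact: cIm.
- exists 1 => U; rewrite -lecR (le_trans (normc_ge_Im _)) //.
  exact/unitary_entry_le1/mx_of_unitaryP.
Qed.

Definition mx_bounded_measurable (p q : nat) (F : borel -> 'M[R[i]]_(p, q)) :=
  forall i j, cbounded_measurable (fun U => F U i j).

Lemma mx_bounded_measurable_cst (p q : nat) (M : 'M[R[i]]_(p, q)) :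
  mx_bounded_measurable (fun=> M).
Proof. by move=> i j; exact: cbounded_measurable_cst. Qed.

Lemma mx_bounded_measurable_mul (p q r : nat) (F : borel -> 'M[R[i]]_(p, q))
    (G : borel -> 'M[R[i]]_(q, r)) :
  mx_bounded_measurable F -> mx_bounded_measurable G ->
  mx_bounded_measurable (fun U => F U *m G U).
Proof.
move=> bF bG i j; under eq_fun do rewrite mxE.
by apply: cbounded_measurable_sum => k; exact: cbounded_measurableM.
Qed.

Lemma mx_bounded_measurable_trmxC (p q : nat) (F : borel -> 'M[R[i]]_(p, q)) :
  mx_bounded_measurable F -> mx_bounded_measurable (fun U => (F U)^t*).
Proof.
by move=> bF i j; under eq_fun do rewrite !mxE; exact: cbounded_measurable_conj.
Qed.

Lemma mx_bounded_measurable_tens (p q r s : nat) (F : borel -> 'M[R[i]]_(p, q))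
    (G : borel -> 'M[R[i]]_(r, s)) :
  mx_bounded_measurable F -> mx_bounded_measurable G ->
  mx_bounded_measurable (fun U => mxtens.tensmx (F U) (G U)).
Proof.
move=> bF bG i j; under eq_fun do rewrite mxE.
exact: cbounded_measurableM.
Qed.

Lemma mx_bounded_measurable_ntens (t : nat) :
  mx_bounded_measurable (fun U => mxtens.ntensmx (mx_of_unitary U) t).
Proof.
(* Powers 0 and 1 are separate base cases: the first is constant, the second is the matrix
   itself. *)
case: t => [|t]; first exact: mx_bounded_measurable_cst.
elim: t => [|t IH]; first exact: cbounded_measurable_entry.
exact: (mx_bounded_measurable_tens cbounded_measurable_entry IH).
Qed.

End Unitary.

(** * Linearity and left invariance of the matrix-valued Haar integral *)

Section HaarIntegral.
Variables (R : realType) (n : nat).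
Local Notation borel := (borel_unitary R n).
Variable mu : probability borel R.

Lemma bounded_measurable_integrable (f : borel -> R) :
  bounded_measurable f -> mu.-integrable setT (EFin \o f).
Proof.
move=> [mf [c hc]]; apply: measurable_bounded_integrable => //.
  by rewrite [X in (X < _)%E]probability_setT ltry.
exists c; split; first exact: num_real.
by move=> d cd U _; rewrite /= (le_trans (hc U)) // ltW.
Qed.

Definition cintegral (f : borel -> R[i]) : R[i] :=
  ((\int[mu]_U complex.Re (f U)) +i* (\int[mu]_U complex.Im (f U)))%C.

Lemma cintegralD (f g : borel -> R[i]) :
  cbounded_measurable f -> cbounded_measurable g ->
  cintegral (fun U => f U + g U) = cintegral f + cintegral g.
Proof.
move=> [rf jf] [rg jg]; apply/eqP; rewrite eq_complex /=; apply/andP; split.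
  by under eq_fun do rewrite raddfD; rewrite RintegralD //;
    exact: bounded_measurable_integrable.
by under eq_fun do rewrite raddfD; rewrite RintegralD //;
  exact: bounded_measurable_integrable.
Qed.

Lemma cintegralZ (c : R[i]) (f : borel -> R[i]) : cbounded_measurable f ->
  cintegral (fun U => c * f U) = c * cintegral f.
Proof.
move=> [rf jf].
have irf := bounded_measurable_integrable rf.
have ijf := bounded_measurable_integrable jf.
have bZ (a : R) (h : borel -> R) : bounded_measurable h ->
    mu.-integrable setT (EFin \o (fun U => a * h U)).
  move=> bh; apply: bounded_measurable_integrable.
  by apply: bounded_measurableM => //; exact: bounded_measurable_cst.
apply/eqP; rewrite eq_complex; apply/andP; split.
  rewrite Re_mulc /=; under eq_fun do rewrite Re_mulc.
  by rewrite RintegralB ?RintegralZl //; exact: bZ.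
rewrite Im_mulc /=; under eq_fun do rewrite Im_mulc.
by rewrite RintegralD ?RintegralZl //; exact: bZ.
Qed.

Lemma cintegral_sum (I : finType) (f : I -> borel -> R[i]) :
  (forall i, cbounded_measurable (f i)) ->
  cintegral (fun U => \sum_i f i U) = \sum_i cintegral (f i).
Proof.
move=> hf; elim: (index_enum I) => [|i r IH].
  under eq_fun do rewrite big_nil; rewrite big_nil.
  by apply/eqP; rewrite eq_complex /= !Rintegral_cst // !mul0r eqxx.
under eq_fun do rewrite big_cons; rewrite big_cons cintegralD ?IH //.
(* Additivity of the integral still asks for measurability and boundedness of the tail sum, obtained
   by a second induction. *)
elim: r {IH} => [|k r IH].
  by under eq_fun do rewrite big_nil; exact: cbounded_measurable_cst.
by under eq_fun do rewrite big_cons; exact: cbounded_measurableD.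
Qed.

(** The entries of [A *m F U *m B] are finite linear combinations of those of [F U], with constant
    coefficients. *)
Lemma mx_integral_mul (p : nat) (A B : 'M[R[i]]_p) (F : borel -> 'M[R[i]]_p) :
  mx_bounded_measurable F ->
  mx_integral mu (fun U => A *m F U *m B) = A *m mx_integral mu F *m B.
Proof.
move=> bF; apply/matrixP => i j; rewrite !mxE.
under [RHS]eq_bigr do rewrite mxE big_distrl /=.
rewrite -/(cintegral (fun U => (A *m F U *m B) i j)).
transitivity (cintegral (fun U => \sum_k \sum_l (A i l * B k j) * F U l k)).
  congr cintegral; apply/funext => U; rewrite mxE; apply: eq_bigr => k _.
  by rewrite mxE big_distrl; apply: eq_bigr => l _; rewrite /= mulrAC.
rewrite cintegral_sum => [|k]; last first.
  apply: cbounded_measurable_sum => l; apply: cbounded_measurableM => //.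
  exact: cbounded_measurable_cst.
apply: eq_bigr => k _; rewrite cintegral_sum => [|l]; last first.
  by apply: cbounded_measurableM => //; exact: cbounded_measurable_cst.
by apply: eq_bigr => l _; rewrite cintegralZ // mxE mulrAC.
Qed.

Hypothesis haar : normalized_haar mu.

Lemma Rintegral_haar (V : unitary R n) (f : borel -> R) :
  bounded_measurable f -> \int[mu]_U f (unitary_mul V U) = \int[mu]_U f U.
Proof.
move=> bf; have [mf [c hc]] := bf; congr fine.
pose phi : borel -> borel := unitary_mul V.
have mphi : measurable_fun setT phi := unitary_mul_measurable V.
(* Left invariance on sets says that [mu] is its own pushforward under translation by [V]; a change
   of variables then finishes. *)
have -> : (\int[mu]_U (f U)%:E = \int[pushforward mu phi]_U (f U)%:E)%E.
  by apply: eq_measure_integral => A mA _; rewrite -[LHS](haar V mA).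
rewrite (integral_pushforward mphi) //; first exact/measurable_EFinP.
apply: (@bounded_measurable_integrable (f \o phi)).
by split; [exact: measurableT_comp mphi|exists c => U; exact: hc].
Qed.

Lemma mx_integral_haar (p : nat) (V : unitary R n) (F : borel -> 'M[R[i]]_p) :
  mx_bounded_measurable F ->
  mx_integral mu (fun U => F (unitary_mul V U)) = mx_integral mu F.
Proof.
move=> bF; apply/matrixP => i j; rewrite !mxE; have [rF jF] := bF i j.
congr (_ +i* _)%C; first exact: (Rintegral_haar V rF).
exact: (Rintegral_haar V jF).
Qed.

End HaarIntegral.

(** * Second moments of designs *)

Local Notation "A *t B" := (mxtens.tensmx A B)
  (at level 40, left associativity).

Lemma mxtrace_dim0 (F : pzRingType) (n : nat) (A : 'M[F]_n) :
  n = 0%N -> \tr A = 0.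
Proof. by case: n A => [A _|//]; rewrite /mxtrace big_ord0. Qed.

Lemma mxtrace_mul_sumr (F : pzRingType) (n : nat) (I : finType) (P : pred I)
    (A : 'M[F]_n) (B : I -> 'M[F]_n) :
  \tr (A *m \sum_(i | P i) B i) = \sum_(i | P i) \tr (A *m B i).
Proof. by rewrite mulmx_sumr raddf_sum. Qed.

Lemma mxtrace_tens (F : comPzRingType) (m n : nat) (A : 'M[F]_m) (B : 'M[F]_n) :
  \tr (A *t B) = \tr A * \tr B.
Proof.
by rewrite /mxtrace mxtens.mulr_sum; apply: eq_bigr => i _; rewrite mxE.
Qed.

Lemma tensmx11 (F : pzRingType) (m n : nat) :
  (1%:M : 'M[F]_m) *t (1%:M : 'M[F]_n) = 1%:M.
Proof.
apply/matrixP => i j.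
case: (mxtens.mxtens_indexP i) => a b; case: (mxtens.mxtens_indexP j) => c d.
rewrite mxtens.tensmxE !mxE -natrM mulnb.
by rewrite (can_eq (@mxtens.mxtens_indexK _ _)) xpair_eqE.
Qed.

Lemma ntensmx_mul (F : comPzRingType) (n t : nat) (A B : 'M[F]_n) :
  mxtens.ntensmx (A *m B) t = mxtens.ntensmx A t *m mxtens.ntensmx B t.
Proof.
case: t => [|t]; first by rewrite mulmx1.
by elim: t => [//|t IH]; rewrite !mxtens.ntensmxSS IH mxtens.tensmx_mul.
Qed.

Section Moment.
Variables (R : realType) (n : nat).
Implicit Types K H W : 'M[R[i]]_n.

Lemma mx_conjugate_mul (p : nat) (A B M : 'M[R[i]]_p) :
  mx_conjugate (A *m B) M = mx_conjugate A (mx_conjugate B M).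
Proof. by rewrite /mx_conjugate trmxC_mul !mulmxA. Qed.

Lemma mx_conjugate_tens (p q : nat) (A C : 'M[R[i]]_p) (B D : 'M[R[i]]_q) :
  mx_conjugate (A *t B) (C *t D) = mx_conjugate A C *t mx_conjugate B D.
Proof.
by rewrite /mx_conjugate mxtens.trmx_tens mxtens.map_mxT !mxtens.tensmx_mul.
Qed.

(* Testing the design identity on these matrices isolates the second moment:
   the trailing identity absorbs the remaining tensor factors. *)
Definition tens2_pad (t : nat) K : 'M[R[i]]_(n ^ t.+2) :=
  K *t (if t is s.+1 return 'M[R[i]]_(n ^ t.+1) then K *t 1%:M else K).

(** Conjugation by a tensor power acts factor by factor and traces multiply. Two factors give the
    same trace, and the identity on the other [t] factors is fixed by the unitary, leaving its trace
    [n ^ t]. *)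
Lemma mxtrace_tens2_pad (t : nat) K H W : W \is unitarymx ->
  \tr (tens2_pad t K *m mx_conjugate (mxtens.ntensmx W t.+2) (tens2_pad t H)) =
  \tr (K *m mx_conjugate W H) ^+ 2 * (n ^ t)%:R.
Proof.
move=> uW; rewrite /tens2_pad mxtens.ntensmxSS mx_conjugate_tens.
rewrite mxtens.tensmx_mul mxtrace_tens expr2 -mulrA; congr (_ * _).
case: t => [|t]; first by rewrite mulr1.
rewrite mxtens.ntensmxSS mx_conjugate_tens mxtens.tensmx_mul mxtrace_tens.
congr (_ * _); rewrite mul1mx /mx_conjugate mulmx1.
have /unitarymxP -> : mxtens.ntensmx W t.+1 \is unitarymx.
  elim: t => [//|t /unitarymxP IH]; apply/unitarymxP.
  move: IH uW => + /unitarymxP.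
  rewrite mxtens.ntensmxSS mxtens.trmx_tens mxtens.map_mxT mxtens.tensmx_mul.
  by move=> -> ->; exact: tensmx11.
by rewrite mxtrace_scalar.
Qed.

Variable mu : probability (borel_unitary R n) R.
Variables (gT : finGroupType) (G : {group gT}).
Variable rG : mx_representation R[i] G n.

(** The design property turns the group sum into [#|G|] times a Haar integral; left invariance makes
    that integral fixed under conjugation by the tensor power of [V]. *)
Lemma design_sum_invariant (t : nat) (M : 'M[R[i]]_(n ^ t)) (V : 'M[R[i]]_n) :
  normalized_haar mu -> unitary_design mu rG t -> V \is unitarymx ->
  \sum_(g in G) mx_conjugate (mxtens.ntensmx (V *m rG g) t) M =
  \sum_(g in G) mx_conjugate (mxtens.ntensmx (rG g) t) M.
Proof.
move=> haar [_ /(_ M) design] uV.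
pose F (U : borel_unitary R n) :=
  mx_conjugate (mxtens.ntensmx (mx_of_unitary U) t) M.
have bF : mx_bounded_measurable F.
  have bT := @mx_bounded_measurable_ntens R n t.
  apply: mx_bounded_measurable_mul; last exact: mx_bounded_measurable_trmxC.
  by apply: mx_bounded_measurable_mul => //; exact: mx_bounded_measurable_cst.
have sumE : \sum_(g in G) mx_conjugate (mxtens.ntensmx (rG g) t) M =
    #|G|%:R *: mx_integral mu F.
  by rewrite -design scalerA divff ?scale1r // pnatr_eq0 -lt0n cardG_gt0.
have invF : mx_conjugate (mxtens.ntensmx V t) (mx_integral mu F) =
    mx_integral mu F.
  rewrite -[RHS](mx_integral_haar haar (to_unitary uV) bF).
  rewrite /mx_conjugate -(mx_integral_mul _ _ _ bF); congr mx_integral.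
  by apply/funext => U; rewrite /F ntensmx_mul mx_conjugate_mul.
rewrite [RHS]sumE -[in RHS]invF.
rewrite [in RHS]/mx_conjugate scalemxAl scalemxAr -sumE mulmx_sumr mulmx_suml.
by apply: eq_bigr => g _; rewrite ntensmx_mul mx_conjugate_mul.
Qed.

Lemma design_second_moment (t : nat) : normalized_haar mu ->
  unitary_design mu rG t.+2 ->
  forall K H V, V \is unitarymx ->
  \sum_(g in G) \tr (K *m mx_conjugate V (mx_conjugate (rG g) H)) ^+ 2 =
  \sum_(g in G) \tr (K *m mx_conjugate (rG g) H) ^+ 2.
Proof.
move=> haar design K H V uV; have [n0|n_gt0] := posnP n.
  by clear design; apply: eq_bigr => g _; rewrite !(mxtrace_dim0 _ n0).
have uG := proj1 design.
have inv := design_sum_invariant (tens2_pad t H) haar design uV.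
clear design.
(* The padding contributes the same factor [n ^ t] on both sides; it is nonzero because [n] is
   positive, so it cancels. *)
have c0 : (n ^ t)%:R != 0 :> R[i] by rewrite pnatr_eq0 -lt0n expn_gt0 n_gt0.
apply: (mulIf c0); rewrite [LHS]mulr_suml [RHS]mulr_suml.
transitivity (\tr (tens2_pad t K *m \sum_(g in G)
    mx_conjugate (mxtens.ntensmx (V *m rG g) t.+2) (tens2_pad t H))).
  rewrite mxtrace_mul_sumr; apply: eq_bigr => g gG.
  rewrite mxtrace_tens2_pad; first by rewrite mx_conjugate_mul.
  by rewrite mul_unitarymx ?uG.
rewrite inv mxtrace_mul_sumr; apply: eq_bigr => g gG.
by rewrite mxtrace_tens2_pad ?uG.
Qed.

End Moment.

Theorem proposition5p6 (R : realType) (n t : nat)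
  (mu : probability (borel_unitary R n) R)
  (gT : finGroupType) (G : {group gT}) (rG : mx_representation R[i] G n)
  (Hs : 'M[R[i]]_n) :
  normalized_haar mu ->
  (2 <= t)%N ->
  unitary_design mu rG t ->
  isu R n Hs ->
  ((1 < n)%N -> Hs != 0) ->
  (forall g0 : gT, g0 \in G ->
     real_span [set mx_conjugate (rG g) Hs | g in [set` G] `\ g0] = isu R n) /\
  (forall X : 'M[R[i]]_n,
     [set mx_conjugate (rG g) Hs | g in [set` G]] X ->
     real_span ([set mx_conjugate (rG g) Hs | g in [set` G]] `\ X) = isu R n).
Proof.
case: t => [|[|t]] haar t2 design iHs Hs0; [by []|by []|].
have moment := design_second_moment haar design.
have uG := proj1 design; clear design.
pose orbit := [set mx_conjugate (rG g) Hs | g in [set` G]].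
have orbit_isu : orbit `<=` isu R n.
  by move=> _ [g gG <-]; exact/isu_conjugate/iHs/uG.
have span X : orbit X -> isu R n `<=` real_span (orbit `\ X).
  exact: orbit_span_remove.
split=> [g0 g0G|X oX]; rewrite eqEsubset; split.
- by apply: real_span_isu => _ [g [gG _] <-]; apply: orbit_isu; exists g.
(* Removing the group element [g0] leaves every orbit matrix other than that of [g0], so the claim
   follows from the removal of a matrix by monotonicity. *)
- apply: subset_trans (real_span_mono _); first by apply: span; exists g0.
  move=> _ [[g gG <-] gX]; exists g => //; split=> // gg0.
  by apply: gX; rewrite gg0.
- by apply: real_span_isu => Y [/orbit_isu].
- exact: span.
Qed.
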